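(* Let $r\ge2$, let $q\ge1$, let $\Gamma\subseteq\{0,\ldots,q-1\}^r$ be nonempty, and assume that there is no probability distribution on $\Gamma$ all of whose $r$ marginals are uniform on $\{0,\dots,q-1\}$. Then there exist functions $$w_i:\{0,\ldots,q-1\}\longrightarrow\mathbb{R}\qquad(1\le i\le r)$$ and a number $\eta>0$ such that $$\sum_{a=0}^{q-1}w_i(a)=0\quad\text{for every }i,\qquad\text{and}\qquad \sum_{i=1}^r w_i(\alpha_i)\ge\eta\quad\text{for every }\alpha=(\alpha_1,\dots,\alpha_r)\in\Gamma.$$ For any such functions and $\eta$, if $W=\sum_{i=1}^r\lVert w_i\rVert_\infty$, then $$H(\Gamma)\le\log q-\frac{\eta^2}{2W^2}.$$ Consequently, if $T$ is a tensor whose support in fixed product bases is $\Gamma$, then for every $n\ge1$ $$\operatorname{srk}(T^{\boxtimes n})\le(n+1)^{|\Gamma|}\left(q\exp\left(-\frac{\eta^2}{2W^2}\right)\right)^n.$$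
   Context: Logarithms are natural. For a probability distribution $\mu$ on a finite set, $H(\mu)=-\sum_x\mu(x)\log\mu(x)$ with $0\log0=0$. For nonempty $\Gamma\subseteq\{0,\dots,q-1\}^r$, $H(\Gamma)=\max_\mu\min_{1\le i\le r}H(\mu_i)$, where $\mu$ ranges over probability distributions on $\Gamma$ and $\mu_i$ is the $i$-th marginal. $\lVert w\rVert_\infty=\max_a|w(a)|$. Let $\mathbb{F}$ be a field. A tensor is a function $T:X_1\times\cdots\times X_r\to\mathbb{F}$ with the $X_i$ finite sets. It is a slice if for some $i$ it can be written as $f(x_i)\,g(x_1,\dots,x_{i-1},x_{i+1},\dots,x_r)$; the slice rank $\operatorname{srk}(T)$ is the least number of slices whose sum is $T$. The tensor power of $T$ is $T^{\boxtimes n}(x^{(1)},\dots,x^{(r)})=\prod_{j=1}^nT(x^{(1)}_j,\dots,x^{(r)}_j)$ with $x^{(i)}\in X_i^n$. Support in fixed product bases: let $X$ be a finite set with $|X|=q$, $T:X^r\to\mathbb{F}$, and for each $i$ fix a basis $(b_{i,0},\dots,b_{i,q-1})$ of the space $\mathbb{F}^X$ of functions $X\to\mathbb{F}$; writing $T(x_1,\dots,x_r)=\sum_{\alpha\in\{0,\dots,q-1\}^r}c_\alpha\prod_{i=1}^rb_{i,\alpha_i}(x_i)$, the support of $T$ is $\{\alpha:c_\alpha\ne0\}$. *)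

(* Defs.v *)
From HB Require Import structures.
From mathcomp Require Import all_boot all_order all_algebra.
From mathcomp Require Import all_classical all_reals all_analysis.

Set Implicit Arguments.
Unset Strict Implicit.
Unset Printing Implicit Defensive.

Import Order.TTheory GRing.Theory Num.Theory.
Import numFieldNormedType.Exports.

Local Open Scope classical_set_scope.
Local Open Scope ring_scope.

Section Entropy.
Variable R : realType.

Definition is_distribution (A : finType) (mu : A -> R) : Prop :=
  (forall x, 0 <= mu x) /\ \sum_x mu x = 1.

(* [ln 0 = 0] in the library, so that [0 * ln 0 = 0]. *)
Definition entropy (A : finType) (mu : A -> R) : R :=
  - \sum_x mu x * ln (mu x).

Variables r q : nat.

(* A distribution on Gamma is extended by 0 to the whole of [q]^r. *)
Definition is_distribution_on (Gamma : {set {ffun 'I_r -> 'I_q}})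
    (mu : {ffun 'I_r -> 'I_q} -> R) : Prop :=
  is_distribution mu /\ forall alpha, alpha \notin Gamma -> mu alpha = 0.

Definition marginal (mu : {ffun 'I_r -> 'I_q} -> R) (i : 'I_r) : 'I_q -> R :=
  fun a => \sum_(alpha : {ffun 'I_r -> 'I_q} | alpha i == a) mu alpha.

Definition uniform_marginals (mu : {ffun 'I_r -> 'I_q} -> R) : Prop :=
  forall i a, marginal mu i a = q%:R^-1.

(* For r > 0 this infimum is a minimum: see [min_marginal_entropyP]. *)
Definition min_marginal_entropy (mu : {ffun 'I_r -> 'I_q} -> R) : R :=
  inf (range (fun i : 'I_r => entropy (marginal mu i))).

(* For r > 0 and Gamma nonempty this supremum is a maximum:
   see [support_entropyP]. *)
Definition support_entropy (Gamma : {set {ffun 'I_r -> 'I_q}}) : R :=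
  sup (min_marginal_entropy @` [set mu | is_distribution_on Gamma mu]).

Definition sup_norm (w : 'I_q -> R) : R := \big[Order.max/0]_(a < q) `|w a|.

Definition is_separating (Gamma : {set {ffun 'I_r -> 'I_q}})
    (w : 'I_r -> 'I_q -> R) (eta : R) : Prop :=
  [/\ 0 < eta,
      forall i, \sum_(a < q) w i a = 0
    & forall alpha, alpha \in Gamma -> eta <= \sum_(i < r) w i (alpha i)].

End Entropy.

Section Tensors.
Variables (F : fieldType) (r : nat).

Definition tensor (X : 'I_r -> finType) : Type := (forall i, X i) -> F.

Definition is_slice (X : 'I_r -> finType) (S : tensor X) : Prop :=
  exists (i : 'I_r) (f : X i -> F)
         (g : (forall j : {j : 'I_r | j != i}, X (val j)) -> F),
    forall x, S x = f (x i) * g (fun j => x (val j)).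

Definition is_sum_of_slices (X : 'I_r -> finType) (T : tensor X) (k : nat) :
    Prop :=
  exists S : 'I_k -> tensor X,
    (forall l, is_slice (S l)) /\ forall x, T x = \sum_(l < k) S l x.

(* The default value 0 is only used when no decomposition exists, which does
   not happen for r > 0: see [slice_rankP]. *)
Definition slice_rank (X : 'I_r -> finType) (T : tensor X) : nat :=
  if pselect (exists k, `[< is_sum_of_slices T k >]) is left h
  then ex_minn h else 0%N.

Definition tensor_power (X : 'I_r -> finType) (T : tensor X) (n : nat) :
    tensor (fun i => {ffun 'I_n -> X i}) :=
  fun x => \prod_(j < n) T (fun i => x i j).


(* [F^o] is F seen as a vector space over itself. *)
Definition has_support (X : finType) (q : nat)
    (b : 'I_r -> q.-tuple {ffun X -> F^o}) (T : tensor (fun=> X))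
    (Gamma : {set {ffun 'I_r -> 'I_q}}) : Prop :=
  exists c : {ffun 'I_r -> 'I_q} -> F,
    (forall x, T x = \sum_(alpha : {ffun 'I_r -> 'I_q})
       c alpha * \prod_(i < r) tnth (b i) (alpha i) (x i)) /\
    Gamma = [set alpha | c alpha != 0]%SET.

End Tensors.

Arguments tensor_power [F r X] T n _.

Section EntropyAttained.
Variable R : realType.

Lemma xlnx_continuous : continuous (fun x : R => x * ln x).
Proof.
have bound (x : R) : x < 1 -> `|x * ln x| <= 2 * Num.sqrt x.
  move=> x1; have [x0|x0] := leP x 0.
    by rewrite ln0// mulr0 normr0 mulr_ge0// sqrtr_ge0.
  have: 0 < Num.sqrt x by rewrite sqrtr_gt0.
  have: x = Num.sqrt x ^+ 2 by rewrite sqr_sqrtr// ltW.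
  move: (Num.sqrt x) => s xs s0.
  rewrite normrM (gtr0_norm x0) ler0_norm ?ln_le0 ?(ltW x1)//.
  rewrite xs lnXn// -mulNrn -lnV ?posrE// expr2.
  have le1 : s * ln s^-1 <= 1.
    rewrite -(mulfV (lt0r_neq0 s0)) ler_pM2l//.
    have := @le_ln1Dx R (s^-1 - 1).
    have -> : 1 + (s^-1 - 1) = s^-1 by rewrite addrC subrK.
    rewrite ltrBrDr addNr invr_gt0 => /(_ s0)/le_trans; apply.
    by rewrite gerBl.
  by rewrite -[ln _ *+ 2]mulr_natl mulrACA [s * 2]mulrC ger_pMr// mulr_gt0.
move=> x; have [x0|x0|->] := ltgtP x 0.
- rewrite /continuous_at [ln x]ln0 ?mulr0 ?(ltW x0)//.
  apply: cvg_near_cst; near=> y; rewrite ln0 ?mulr0//; apply: ltW; near: y.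
  exact: lt_nbhsl.
- by apply: cvgM; [exact: cvg_id | exact: continuous_ln].
- rewrite /continuous_at mul0r; apply/norm_cvg0P.
  apply: (@squeeze_cvgr _ _ _ _ (fun=> 0) (fun y => 2 * Num.sqrt y)).
  + near=> y; rewrite normr_ge0 /=; apply: bound; near: y.
    by apply: lt_nbhsl; rewrite ltr01.
  + exact: cvg_cst.
  + rewrite -[X in _ --> X](mulr0 2); apply: cvgM; first exact: cvg_cst.
    by have := @sqrt_continuous R 0; rewrite /continuous_at sqrtr0.
Unshelve. all: by end_near. Qed.

Lemma continuous_bigsum (S : topologicalType) (I : Type) (s : seq I)
    (P : pred I) (f : I -> S -> R) :
  (forall i, continuous (f i)) -> continuous (fun x => \sum_(i <- s | P i) f i x).
Proof.
move=> cf; elim: s => [|i s IHs] x.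
  under eq_fun do rewrite big_nil; exact: cvg_cst.
under eq_fun do rewrite big_cons.
rewrite /continuous_at; case: ifP => _; last exact: IHs.
by apply: cvgD; [exact: cf | exact: IHs].
Qed.

Lemma continuous_bigmin (S : topologicalType) (I : Type) (s : seq I)
    (f0 : S -> R) (f : I -> S -> R) : continuous f0 ->
  (forall i, continuous (f i)) ->
  continuous (fun x => \big[Order.min/f0 x]_(i <- s) f i x).
Proof.
move=> cf0 cf; elim: s => [|i s IHs] x.
  under eq_fun do rewrite big_nil.
  exact: cf0.
under eq_fun do rewrite big_cons.
apply: (@continuous_comp S (R * R)%type R
  (fun x => (f i x, \big[Order.min/f0 x]_(i <- s) f i x))
  (fun z => Order.min z.1 z.2)); last exact: (@min_continuous _ R).
by apply: (cvg_pair (cf i x) (IHs x)).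
Qed.

Variables r q : nat.
Hypothesis r_gt0 : (0 < r)%N.
Local Notation A := {ffun 'I_r -> 'I_q}.
Implicit Type mu : A -> R.

Lemma min_marginal_entropyE mu : min_marginal_entropy mu =
  \big[Order.min/entropy (marginal mu (Ordinal r_gt0))]_i
     entropy (marginal mu i).
Proof.
set m := RHS; rewrite /min_marginal_entropy.
have lbm : lbound (range (fun i => entropy (marginal mu i))) m.
  by move=> _ [i _ <-]; exact: bigmin_le.
have [i _ mi] : exists2 i, true & m = entropy (marginal mu i).
  rewrite /m; elim/big_ind : _ => [|x y [i _ ->] [j _ ->]|i _].
  - by exists (Ordinal r_gt0).
  - by rewrite minEle; case: ifP => _; [exists i | exists j].
  - by exists i.
apply/eqP; rewrite eq_le; apply/andP; split.
  by rewrite mi; apply: ge_inf; [exists m | exists i].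
by apply: lb_le_inf => //; exists m, i.
Qed.

Lemma min_marginal_entropyP mu :
  (exists i, min_marginal_entropy mu = entropy (marginal mu i)) /\
  forall i, min_marginal_entropy mu <= entropy (marginal mu i).
Proof.
rewrite min_marginal_entropyE; split; last by move=> i; exact: bigmin_le.
elim/big_ind : _ => [|x y [i ->] [j ->]|i _].
- by exists (Ordinal r_gt0).
- by rewrite minEle; case: ifP => _; [exists i | exists j].
- by exists i.
Qed.

Lemma support_entropyP (Gamma : {set A}) : Gamma != finset.set0 ->
  (exists2 mu, is_distribution_on Gamma mu &
     support_entropy R Gamma = min_marginal_entropy mu) /\
  forall mu, is_distribution_on Gamma mu ->
     min_marginal_entropy mu <= support_entropy R Gamma.
Proof.
move=> /finset.set0Pn[a0 a0G].
pose S : topologicalType := prod_topology (fun _ : A => R).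
pose D : set S := [set mu | is_distribution_on Gamma mu].
have cev (a : A) : continuous (fun mu : S => mu a : R).
  exact: (@proj_continuous _ (fun _ : A => R) a).
have D0 : D !=set0.
  exists (fun a => (a == a0)%:R); split; first split.
  - by move=> a; rewrite ler0n.
  - by rewrite (bigD1 a0)//= eqxx big1 ?addr0// => a /negbTE ->.
  - by move=> a; case: eqP => // ->; rewrite a0G.
have cD : compact D.
  apply: (@subclosed_compact S _
    [set mu | forall a, [set` `[0 : R, 1]] (mu a)]).
  - have -> : D =
      (\bigcap_a [set mu : S | 0 <= mu a]) `&`
      [set mu : S | \sum_a mu a = 1] `&`
      (\bigcap_(a in [set a | a \notin Gamma]) [set mu : S | mu a = 0]).
      apply/seteqP; split => mu.
        by move=> [[m0 m1] mG]; split; [split|] => // a _; exact: m0.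
      by move=> [[m0 m1] mG]; split; [split|] => // a; exact: m0.
    apply: closedI; first apply: closedI.
    + apply: closed_bigI => a _.
      apply: (@preimage_closed S R (fun mu => mu a) [set x | 0 <= x]).
        by move=> x _; exact: cev.
      exact: closed_ge.
    + apply: (@preimage_closed S R (fun mu => \sum_a mu a) [set x | x = 1]).
        by move=> x _; exact: continuous_bigsum.
      exact: closed_eq.
    + apply: closed_bigI => a _.
      apply: (@preimage_closed S R (fun mu => mu a) [set x | x = 0]).
        by move=> x _; exact: cev.
      exact: closed_eq.
  - apply: (@tychonoff _ (fun _ : A => R) (fun=> [set` `[0 : R, 1]])) => a.
    exact: segment_compact.
  - move=> mu [[m0 m1] _] a /=; rewrite in_itv /= m0 /= -m1 (bigD1 a)//=.
    by rewrite lerDl sumr_ge0.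
have cm i a : continuous (fun mu : S => marginal mu i a : R).
  exact: continuous_bigsum.
have cx i a : continuous (fun mu : S => marginal mu i a * ln (marginal mu i a)).
  move=> mu; apply: (@continuous_comp S R R _ (fun x => x * ln x)).
    exact: cm.
  exact: xlnx_continuous.
have ce i : continuous (fun mu : S => entropy (marginal mu i) : R).
  move=> mu; apply: (@continuous_comp S R R
    (fun mu : S => \sum_a marginal mu i a * ln (marginal mu i a)) -%R).
    by apply: continuous_bigsum; exact: cx.
  exact: opp_continuous.
have cf : {within D, continuous (fun mu : S => min_marginal_entropy mu : R)}.
  apply: continuous_subspaceT.
  rewrite (_ : (fun mu => _) = (fun mu : S =>
    \big[Order.min/entropy (marginal mu (Ordinal r_gt0))]_i
     entropy (marginal mu i))); last first.
    by apply/funext => mu; exact: min_marginal_entropyE.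
  by apply: continuous_bigmin.
have [c /set_mem Dc cmax] := compact_EVT_max D0 cD cf.
have ubc : ubound (@min_marginal_entropy R r q @` D) (min_marginal_entropy c).
  by move=> _ [mu Dmu <-]; apply: cmax; exact/mem_set.
have -> : support_entropy R Gamma = min_marginal_entropy c.
  apply/eqP; rewrite eq_le; apply/andP; split.
    by apply: ge_sup => //; exists (min_marginal_entropy c), c.
  by apply: ub_le_sup; [exists (min_marginal_entropy c) | exists c].
by split=> [|mu Dmu]; [exists c | apply: cmax; exact/mem_set].
Qed.

End EntropyAttained.

Lemma is_sum_of_slices_exists (F : fieldType) (r : nat) (X : 'I_r -> finType)
  (T : tensor F X) : (0 < r)%N -> exists k, is_sum_of_slices T k.
Proof.
move=> r0; pose i0 := Ordinal r0.
pose rest (x : forall i, X i) := fun j : {j : 'I_r | j != i0} => x (val j).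
pose g a y : F := xget 0 [set v | exists x, [/\ x i0 = a, rest x = y & v = T x]].
have gE x : g (x i0) (rest x) = T x.
  rewrite /g; case: xgetP => [v _ [x' [xi xr ->]]|/(_ (T x))]; last first.
    by case; exists x.
  congr T; apply: functional_extensionality_dep => j.
  have [->//|ji] := eqVneq j i0.
  exact: (congr1 (fun y => y (exist _ j ji)) xr).
exists #|X i0|, (fun l x => (x i0 == enum_val l)%:R * g (enum_val l) (rest x)).
split=> [l|x].
  by exists i0, (fun a => (a == enum_val l)%:R), (g (enum_val l)).
rewrite -(big_enum_val (fun a => (x i0 == a)%:R * g a (rest x))) /=.
rewrite (bigD1 (x i0))//= eqxx mul1r gE big1 ?addr0// => a.
by rewrite eq_sym => /negbTE ->; rewrite mul0r.
Qed.

Lemma slice_rankP (F : fieldType) (r : nat) (X : 'I_r -> finType)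
    (T : tensor F X) : (0 < r)%N ->
  is_sum_of_slices T (slice_rank T) /\
  forall k, is_sum_of_slices T k -> (slice_rank T <= k)%N.
Proof.
move=> r0; rewrite /slice_rank; case: pselect => [h|[]]; last first.
  by have [k Tk] := is_sum_of_slices_exists T r0; exists k; apply/asboolP.
by case: ex_minnP => m /asboolP Tm mmin; split=> // k Tk; apply/mmin/asboolP.
Qed.

(* Main.v *)
Require Import Defs.
From HB Require Import structures.
From mathcomp Require Import all_boot all_order all_algebra.
From mathcomp Require Import all_classical all_reals all_analysis.
From mathcomp Require Import ring lra zify.

Set Implicit Arguments.
Unset Strict Implicit.
Unset Printing Implicit Defensive.

Import Order.TTheory GRing.Theory Num.Theory.
Import numFieldNormedType.Exports.
Local Open Scope ring_scope.

(** Existence of [w] and [eta] is the separation of the uniform point from the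
compact convex set of marginal vectors of distributions on [Gamma]
([separating_exists]). The separating functional comes from the nearest point
projection: let [c] be a distribution on [Gamma] whose marginals are at minimal
squared distance from uniform, and let [w i] be the [i]-th marginal of [c] minus
the uniform distribution. Moving [c] towards a point mass at [alpha] in [Gamma]
cannot decrease the distance, and the first order condition says precisely that
the sum of the [w i (alpha i)] is at least the squared distance [eta], which is
positive because uniform marginals are excluded.

For the quantitative part, put [t = eta / W]. Averaging the separating
inequality against a distribution on [Gamma] and comparing with
[eta = \sum_i t * M_i], where [M_i] is the sup norm of [w i], produces a
direction [i] in which the average of [w i] is at least [t * M_i]
([exists_direction]). Everything then follows from Hoeffding's bound
on the exponential moment of a function of mean zero
([sum_expR_le]), used in two ways. Through Gibbs' variational principle it says
that a distribution with such a large average of [w i] has entropy at most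
[ln q - t ^ 2 / 2] ([entropy_le]). Through Markov's inequality it says that at
most [(q * exp (- t ^ 2 / 2)) ^ n] words of length [n] have a letter average of
[w i] that large ([card_large_sum_le]).

The tensor power is a sum over words [beta] of length [n] in [Gamma] of products
of one function of each variable, the [i]-th one depending only on the word
[beta_i] of [i]-th coordinates. Apply the existence of a large direction to the
empirical distribution of [beta] to choose a direction [i], and group the terms
by the pair [(i, beta_i)]: each group is a slice, because it has a common factor
depending on the [i]-th variable ([is_sum_of_slices_labels]). For a given
direction the possible [beta_i] are the words counted above. The direction
depends only on how often each letter occurs in [beta], so the number of
directions in use is at most the number [(n + 1) ^ #|Gamma|] of such occurrence
counts ([slice_rank_power_le]). *)

(** * Exponential moments, entropy and large deviations *)

Section ExponentialMoment.
Variable R : realType.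
Implicit Types x y s t M : R.

Lemma double_fact_ge j : (2 ^ j * j`! <= j.*2`!)%N.
Proof.
elim: j => // j IHj; rewrite doubleS !factS expnS.
rewrite [X in (X <= _)%N](_ : _ = (j.*2.+2 * (2 ^ j * j`!))%N); last first.
  by rewrite -doubleS -muln2; lia.
by rewrite leq_mul2l (leq_trans IHj) ?orbT// leq_pmull.
Qed.

(** Only even powers survive in the series of [expR x + expR (- x)], and there
[double_fact_ge] compares it termwise with the series of
[2 * expR (x ^+ 2 / 2)]. *)
Lemma cosh_partial_sum_le x n :
  \sum_(0 <= k < n.*2) (exp_coeff x k + exp_coeff (- x) k) <=
  2 * \sum_(0 <= j < n) exp_coeff (x ^+ 2 / 2) j.
Proof.
elim: n => [|n IHn]; first by rewrite !big_nil mulr0.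
rewrite doubleS !big_nat_recr//= mulrDr -addrA lerD//.
have even_sign : (-1) ^+ n.*2 = 1 :> R by rewrite -signr_odd odd_double.
rewrite /exp_coeff /= !(exprNn x) (exprS (-1)) even_sign mulr1 mul1r mulN1r.
rewrite mulNr addrN addr0 -mulr2n -[leLHS]mulr_natl.
rewrite ler_pM2l// expr_div_n -exprM mul2n -mulrA ler_wpM2l//.
  by rewrite -mul2n exprM exprn_ge0// sqr_ge0.
rewrite -invfM lef_pV2 ?posrE ?mulr_gt0 ?exprn_gt0 ?ltr0n ?fact_gt0//.
by rewrite -natrX -natrM ler_nat double_fact_ge.
Qed.

(** The inequality [cosh x <= expR (x ^+ 2 / 2)], with the sharp constant in the
exponent. *)
Lemma cosh_le_expR x : expR x + expR (- x) <= 2 * expR (x ^+ 2 / 2).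
Proof.
have cvgs y := is_cvg_series_exp_coeff y.
rewrite /expR -limD//; apply: limr_le; first exact: is_cvgD.
near=> n.
(* The terms are nonnegative, so it is enough to bound the partial sums of even
   length. *)
rewrite [leLHS](_ : _ =
  \sum_(0 <= k < n) (exp_coeff x k + exp_coeff (- x) k)); last first.
  by rewrite big_split.
have nonneg k : 0 <= exp_coeff x k + exp_coeff (- x) k.
  rewrite /exp_coeff /= -mulrDl divr_ge0//.
  rewrite (exprNn x) -signr_odd; have [ok|ek] := boolP (odd k).
    by rewrite expr1 mulN1r addrN.
  by rewrite expr0 mul1r addr_ge0// exprn_even_ge0.
apply: (le_trans (nondecreasing_series (fun k _ _ => nonneg k) (leq_addl n n))).
rewrite addnn; apply: (le_trans (cosh_partial_sum_le x n)).
rewrite ler_pM2l//.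
apply: (@nondecreasing_cvgn_le _ (series (exp_coeff (x ^+ 2 / 2)))) => //.
apply: nondecreasing_series => k _ _.
by rewrite exp_coeff_ge0// divr_ge0 ?sqr_ge0.
Unshelve. all: by end_near. Qed.

(** By convexity the exponential lies below its chord between [- t] and [t]; the
two tangent inequalities at [s * t], weighted by [1 + s] and [1 - s], add up to
it. *)
Lemma expR_chord s t : `|s| <= 1 ->
  2 * expR (s * t) <= (1 + s) * expR t + (1 - s) * expR (- t).
Proof.
rewrite ler_norml => /andP[s1 s2].
have tangent y : expR (s * t) * (1 + (y - s * t)) <= expR y.
  rewrite -[in leRHS](subrKC (s * t) y) expRD.
  by rewrite ler_pM2l ?expR_gt0// expR_ge1Dx.
have h1 := @ler_wpM2l _ (1 + s) ltac:(lra) _ _ (tangent t).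
have h2 := @ler_wpM2l _ (1 - s) ltac:(lra) _ _ (tangent (- t)).
apply: le_trans (lerD h1 h2); rewrite le_eqVlt; apply/orP; left; apply/eqP.
by ring.
Qed.

(** Hoeffding's lemma: the chord bound is affine in [w a], so after summation
the linear term disappears and [cosh t] remains. *)
Lemma sum_expR_le (A : finType) (w : A -> R) M t : 0 < M ->
  (forall a, `|w a| <= M) -> \sum_a w a = 0 ->
  \sum_a expR (t / M * w a) <= #|A|%:R * expR (t ^+ 2 / 2).
Proof.
move=> M0 wM w0; rewrite -(ler_pM2l (ltr0Sn R 1)) mulr_sumr.
have chord a : 2 * expR (t / M * w a) <=
    (expR t + expR (- t)) + w a * ((expR t - expR (- t)) / M).
  rewrite (_ : t / M * w a = w a / M * t); last by ring.
  apply: le_trans (expR_chord _ _) _.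
    by rewrite normrM normfV (gtr0_norm M0) ler_pdivrMr// mul1r.
  by rewrite le_eqVlt; apply/orP; left; apply/eqP; ring.
apply: (le_trans (ler_sum _ (fun a _ => chord a))).
rewrite big_split /= -mulr_suml w0 mul0r addr0 sumr_const.
rewrite -[leLHS]mulr_natl mulrCA.
by rewrite ler_wpM2l ?cosh_le_expR.
Qed.

(** Gibbs' variational principle: [entropy nu] plus the [nu]-average of
[t / M * w] is at most the logarithm of the sum of [expR (t / M * w a)], which
[sum_expR_le] bounds; the choice of [t / M] as exponent is the optimal one for
an average of at least [t * M]. *)
Lemma entropy_le (A : finType) (nu w : A -> R) M t :
  is_distribution nu -> 0 < M -> (forall a, `|w a| <= M) -> \sum_a w a = 0 ->
  0 <= t -> t * M <= \sum_a nu a * w a ->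
  entropy nu <= ln #|A|%:R - t ^+ 2 / 2.
Proof.
move=> [nu0 nu1] M0 wM w0 t0 tM.
have A0 : 0 < #|A|%:R :> R.
  rewrite ltr0n lt0n; apply/negP => /eqP A0; move: nu1.
  rewrite big_pred0 => [/eqP|a]; first by rewrite eq_sym oner_eq0.
  exact: card0_eq A0 a.
set B := #|A|%:R * expR (t ^+ 2 / 2).
have B0 : 0 < B by rewrite mulr_gt0 ?expR_gt0.
(* The inequality [ln z <= z - 1] at [z = expR (t / M * w a) / (B * nu a)]; the
   case [nu a = 0] is apart. *)
have gibbs a : nu a * (t / M * w a - ln (nu a) - ln B) <=
    expR (t / M * w a) / B - nu a.
  move: (nu0 a); rewrite le_eqVlt => /orP[/eqP<-|na].
    by rewrite mul0r subr0 divr_ge0 ?expR_ge0// ltW.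
  set z := expR (t / M * w a) / B / nu a.
  have z0 : 0 < z by rewrite !divr_gt0 ?expR_gt0.
  have -> : t / M * w a - ln (nu a) - ln B = ln z.
    by rewrite /z !ln_div ?posrE ?divr_gt0 ?expR_gt0// expRK; ring.
  have -> : expR (t / M * w a) / B - nu a = nu a * (z - 1).
    by rewrite /z; field; rewrite !gt_eqF.
  rewrite ler_pM2l//; have := @le_ln1Dx _ (z - 1).
  by rewrite subrKC; apply; rewrite ltrBrDr addNr.
have := ler_sum (index_enum A) (fun a (_ : true) => gibbs a).
rewrite sumrB nu1 -mulr_suml.
have -> : \sum_a nu a * (t / M * w a - ln (nu a) - ln B) =
    t / M * (\sum_a nu a * w a) + entropy nu - ln B.
  rewrite /entropy mulr_sumr -sumrB -[ln B in RHS]mul1r -nu1 mulr_suml -sumrB.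
  by apply: eq_bigr => a _; ring.
have Z1 : (\sum_a expR (t / M * w a)) / B <= 1.
  by rewrite ler_pdivrMr// mul1r sum_expR_le.
have t2 : t ^+ 2 <= t / M * \sum_a nu a * w a.
  rewrite (_ : t ^+ 2 = t / M * (t * M)); last by field; rewrite gt_eqF.
  by rewrite ler_wpM2l// divr_ge0// ltW.
rewrite lnM ?posrE ?expR_gt0// expRK; lra.
Qed.

(** Chernoff's method: every word in the set contributes at least
[expR (n%:R * t ^+ 2)] to the sum of [expR (t / M * \sum_j w (a j))] over all
words, which factors into [n] copies of the sum in [sum_expR_le]. *)
Lemma card_large_sum_le (A : finType) (w : A -> R) M t n :
  0 < M -> (forall a, `|w a| <= M) -> \sum_a w a = 0 -> 0 <= t ->
  #|[set a : {ffun 'I_n -> A} | n%:R * (t * M) <= \sum_j w (a j)]%SET|%:R <=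
    (#|A|%:R * expR (- (t ^+ 2 / 2))) ^+ n.
Proof.
move=> M0 wM w0 t0; set S := [set _ | _]%SET.
have tM : 0 <= t / M by rewrite divr_ge0// ltW.
have -> : (#|A|%:R * expR (- (t ^+ 2 / 2))) ^+ n =
    (#|A|%:R * expR (t ^+ 2 / 2)) ^+ n / expR (n%:R * t ^+ 2).
  rewrite expRM_natl -expr_div_n -[in RHS]mulrA -expRN -expRD.
  by congr ((_ * expR _) ^+ _); field.
rewrite ler_pdivlMr ?expR_gt0//.
apply: (@le_trans _ _
  (\sum_(a : {ffun 'I_n -> A}) \prod_j expR (t / M * w (a j)))).
  rewrite [leLHS]mulr_natl -[leLHS]sumr_const [leLHS]big_mkcond /=.
  apply: ler_sum => a _.
  rewrite -expR_sum -mulr_sumr; case: ifPn => [|_]; last exact: expR_ge0.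
  rewrite finset.inE => aS; rewrite ler_expR.
  have -> : n%:R * t ^+ 2 = t / M * (n%:R * (t * M)).
    by field; rewrite gt_eqF.
  by rewrite ler_wpM2l.
rewrite -(bigA_distr_bigA (fun=> fun a => expR (t / M * w a))) /=.
rewrite prodr_const card_ord lerXn2r ?nnegrE ?sum_expR_le//.
by rewrite sumr_ge0// => a _; exact: expR_ge0.
Qed.

End ExponentialMoment.

(** * Separation from the uniform marginals *)

Section Separation.
Variables (R : realType) (r q : nat).
Local Notation A := {ffun 'I_r -> 'I_q}.
Local Open Scope classical_set_scope.
Local Open Scope ring_scope.

(** The set is closed in the cube [[0, 1]^A], which is compact by Tychonoff's
theorem. *)
Lemma compact_distributions_on (Gamma : {set A}) :
  compact ([set mu | is_distribution_on Gamma mu]%classic :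
    set (prod_topology (fun _ : A => R))).
Proof.
pose S : topologicalType := prod_topology (fun _ : A => R).
have cev a : continuous (fun mu : S => mu a : R).
  exact: (@proj_continuous _ (fun _ : A => R) a).
apply: (@subclosed_compact S _
  [set mu | forall a, [set` `[0 : R, 1]] (mu a)]); last first.
- move=> mu [[m0 m1] _] a /=; rewrite in_itv /= m0 /= -m1 (bigD1 a)//=.
  by rewrite lerDl sumr_ge0.
- apply: (@tychonoff _ (fun _ : A => R) (fun=> [set` `[0 : R, 1]])) => a.
  exact: segment_compact.
rewrite (_ : mkset _ = (\bigcap_(a : A) [set mu : S | 0 <= mu a] `&`
    ((fun mu : S => \sum_a mu a) @^-1` [set x | x = 1] `&`
    \bigcap_(a in [set a | a \notin Gamma]) [set mu : S | mu a = 0]))%classic).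
  apply: closedI; last apply: closedI.
  + apply: closed_bigI => a _.
    apply: (@preimage_closed S R (fun mu => mu a) [set x | 0 <= x]) => [x _|].
      exact: cev.
    exact: closed_ge.
  + apply: (@preimage_closed S R (fun mu => \sum_a mu a) [set x | x = 1])
      => [x _|].
      exact: continuous_bigsum.
    exact: closed_eq.
  + apply: closed_bigI => a _.
    apply: (@preimage_closed S R (fun mu => mu a) [set x | x = 0]) => [x _|].
      exact: cev.
    exact: closed_eq.
apply/seteqP; split => mu /=.
  by move=> [[m0 m1] mG]; split; [|split] => // a _; exact: m0.
by move=> [m0 [m1 mG]]; split; [split|] => // a; exact: m0.
Qed.

Lemma sum_marginal (mu : A -> R) i (f : 'I_q -> R) :
  \sum_a marginal mu i a * f a = \sum_alpha mu alpha * f (alpha i).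
Proof.
rewrite (partition_big (fun alpha : A => alpha i) xpredT)//=.
apply: eq_bigr => a _; rewrite mulr_suml.
by apply: eq_bigr => alpha /eqP ->.
Qed.

Lemma marginal_distribution (mu : A -> R) i :
  is_distribution mu -> is_distribution (marginal mu i).
Proof.
move=> [mu0 mu1]; split=> [a|]; first exact: sumr_ge0.
rewrite -mu1; have := sum_marginal mu i (fun=> 1).
by under eq_bigr do rewrite mulr1; under [in RHS]eq_bigr do rewrite mulr1.
Qed.

Definition uniform_dist2 (mu : A -> R) : R :=
  \sum_i \sum_a (marginal mu i a - q%:R^-1) ^+ 2.

Lemma continuous_uniform_dist2 :
  continuous (uniform_dist2 : prod_topology (fun _ : A => R) -> R).
Proof.
have sq_continuous : continuous (fun x : R => (x - q%:R^-1) ^+ 2).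
  move=> x; apply: (@continuous_comp R R R (fun y => y - q%:R^-1)
    (fun y => y ^+ 2)); last exact: exprn_continuous.
  by apply: cvgB; [exact: cvg_id|exact: cvg_cst].
apply: continuous_bigsum => i; apply: continuous_bigsum => a mu.
apply: (@continuous_comp _ R R (fun mu : prod_topology (fun _ : A => R) =>
  marginal mu i a : R) (fun x => (x - q%:R^-1) ^+ 2));
  last exact: sq_continuous.
apply: continuous_bigsum => alpha.
exact: (@proj_continuous _ (fun _ : A => R) alpha).
Qed.

(** First order condition for a minimum at the left end of a segment. *)
Lemma ge0_of_quadratic (a b : R) :
  (forall s, 0 <= s <= 1 -> 0 <= s * a + s ^+ 2 * b) -> 0 <= a.
Proof.
move=> h; rewrite leNgt; apply/negP => a0.
have d0 : 0 < `|b| - a by rewrite subr_gt0 (lt_le_trans a0).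
(* For this [s] one has [s * `|b| <= - a / 2], and the summand [- a] in the
   denominator keeps [s <= 1]. *)
set s := - a / (2 * (`|b| - a)).
have s0 : 0 < s by rewrite divr_gt0 ?oppr_gt0 ?mulr_gt0.
have s1 : s <= 1.
  by rewrite ler_pdivrMr ?mul1r ?mulr_gt0//; have := normr_ge0 b; lra.
have := h s; rewrite (ltW s0) s1 => /(_ isT).
rewrite expr2 -mulrA -mulrDr pmulr_rge0// leNgt => /negP; apply.
have sb : s * `|b| <= - a / 2.
  rewrite /s mulrAC ler_pdivrMr ?mulr_gt0// [leRHS](_ : _ = - a * (`|b| - a)).
    by rewrite ler_wpM2l ?oppr_ge0 ?ltW// ; lra.
  by field.
have := ler_norm b => bb; have := ler_wpM2l (ltW s0) bb; lra.
Qed.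

(** [w] is the vector from the uniform point to the nearest marginal vector, and
[eta] is its squared length. *)
Lemma separating_exists (Gamma : {set A}) : (0 < q)%N -> Gamma != finset.set0 ->
  (~ exists mu : A -> R, is_distribution_on Gamma mu /\ uniform_marginals mu) ->
  exists (w : 'I_r -> 'I_q -> R) (eta : R), is_separating Gamma w eta.
Proof.
move=> q_gt0 /finset.set0Pn[a0 a0G] nunif.
pose delta alpha : A -> R := fun beta => (beta == alpha)%:R.
have sum_delta alpha (f : A -> R) :
    \sum_beta delta alpha beta * f beta = f alpha.
  rewrite (bigD1 alpha)//= /delta eqxx mul1r big1 ?addr0// => beta /negbTE ->.
  by rewrite mul0r.
have delta_on alpha : alpha \in Gamma -> is_distribution_on Gamma (delta alpha).
  move=> aG; split; first split.
  - by move=> beta; rewrite /delta ler0n.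
  - rewrite -[RHS](sum_delta alpha (fun=> 1)).
    by apply: eq_bigr => beta _; rewrite mulr1.
  - by move=> beta; rewrite /delta; case: eqP => // ->; rewrite aG.
have q0 : (q%:R : R) != 0 by rewrite pnatr_eq0 -lt0n.
have [|c /set_mem Dc cmin] := compact_EVT_min _
    (@compact_distributions_on Gamma)
    (continuous_subspaceT continuous_uniform_dist2).
  by exists (delta a0); exact: delta_on.
have {}cmin mu : is_distribution_on Gamma mu ->
    uniform_dist2 c <= uniform_dist2 mu.
  by move=> Dmu; apply: cmin; exact/mem_set.
pose v i a := marginal c i a - q%:R^-1.
have v0 i : \sum_a v i a = 0.
  rewrite sumrB (marginal_distribution i Dc.1).2 sumr_const card_ord.
  by rewrite -[_ *+ q]mulr_natl mulfV// subrr.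
exists v, (uniform_dist2 c); split=> // [|alpha aG].
  have dist_ge0 : 0 <= uniform_dist2 c.
    by do 2 (apply: sumr_ge0 => ? _); exact: sqr_ge0.
  rewrite lt_neqAle dist_ge0 andbT eq_sym; apply/negP => /eqP dist0.
  apply: nunif; exists c; split=> // i a; apply/eqP.
  rewrite -subr_eq0 -sqrf_eq0.
  have sq_ge0 j b : true -> 0 <= (marginal c j b - q%:R^-1) ^+ 2.
    by move=> _; exact: sqr_ge0.
  have row0 := psumr_eq0P (fun j _ => sumr_ge0 _ (sq_ge0 j)) dist0.
  by apply/eqP; apply: (psumr_eq0P (sq_ge0 i)) => //; exact: row0.
pose d i a := (a == alpha i)%:R - marginal c i a : R.
pose path s : A -> R := fun beta => (1 - s) * c beta + s * delta alpha beta.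
have marginal_path s i a : marginal (path s) i a - q%:R^-1 = v i a + s * d i a.
  rewrite /marginal big_split /= -!mulr_sumr.
  have -> : \sum_(beta : A | beta i == a) delta alpha beta = (a == alpha i)%:R.
    rewrite big_mkcond /= -(sum_delta alpha (fun beta => (a == beta i)%:R)).
    apply: eq_bigr => beta _; rewrite eq_sym; case: eqP => _.
      by rewrite mulr1.
    by rewrite mulr0.
  by rewrite /v /d /marginal; ring.
have path_on s : 0 <= s <= 1 -> is_distribution_on Gamma (path s).
  move=> /andP[s0 s1]; have Da := delta_on _ aG; split; first split.
  - by move=> beta; rewrite addr_ge0// mulr_ge0 ?subr_ge0 ?Dc.1.1 ?Da.1.1.
  - by rewrite big_split /= -!mulr_sumr Dc.1.2 Da.1.2; ring.
  - by move=> beta bG; rewrite /path Dc.2// Da.2//; ring.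
(* The squared distance along the segment from [c] to the point mass at [alpha]
   is quadratic in [s], and minimal at [s = 0]. *)
have : 0 <= 2 * \sum_i \sum_a v i a * d i a.
  apply: (@ge0_of_quadratic _ (\sum_i \sum_a d i a ^+ 2)) => s s01.
  have := cmin _ (path_on _ s01); rewrite -subr_ge0 [X in 0 <= X -> _](_ : _ =
    s * (2 * \sum_i \sum_a v i a * d i a) +
    s ^+ 2 * \sum_i \sum_a d i a ^+ 2) //.
  rewrite /uniform_dist2 -sumrB mulrA 2!mulr_sumr -big_split.
  apply: eq_bigr => i _ /=; rewrite -sumrB 2!mulr_sumr -big_split.
  apply: eq_bigr => a _ /=.
  by rewrite marginal_path -/(v i a); ring.
rewrite pmulr_rge0// [X in 0 <= X -> _](_ : _ =
  \sum_i v i (alpha i) - uniform_dist2 c) ?subr_ge0//.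
rewrite /uniform_dist2 -sumrB; apply: eq_bigr => i _ /=.
have -> : v i (alpha i) = \sum_a (a == alpha i)%:R * v i a.
  rewrite (bigD1 (alpha i))//= eqxx mul1r big1 ?addr0// => a /negbTE ->.
  by rewrite mul0r.
(* As [v i] has sum zero, subtracting a multiple of that sum turns
   [v i a * marginal c i a] into [v i a ^+ 2]. *)
rewrite -[RHS]addr0 -[X in _ = _ + X](mulr0 (- q%:R^-1)).
rewrite -[X in _ = _ + _ * X](v0 i) mulr_sumr -sumrB -big_split.
apply: eq_bigr => a _ /=.
by rewrite /d /v; ring.
Qed.

End Separation.

(** * Slice decompositions *)

Section SliceDecompositions.
Variables (F : fieldType) (r : nat) (X : 'I_r -> finType).
Implicit Types T U : tensor F X.

Lemma is_sum_of_slices_set (K : finType) (P : {set K}) (S : K -> tensor F X) U :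
  (forall k, is_slice (S k)) -> (forall x, U x = \sum_(k in P) S k x) ->
  is_sum_of_slices U #|P|.
Proof.
move=> sS US; exists (fun l => S (enum_val l)); split=> // x.
by rewrite US big_enum_val.
Qed.

(** In a sum of product terms, let the [i]-th factor of the term [beta] depend
only on a label [h i beta]. Assign to each term a direction [d beta]. The terms
with direction [i] and label [k] in that direction share the factor [g i k], so
they add up to one slice, and there are as many slices as pairs [(i, k)]. *)
Lemma is_sum_of_slices_labels (B K : finType) (C : B -> F) (h : 'I_r -> B -> K)
    (g : forall i, K -> X i -> F) (d : B -> 'I_r) (P : {set 'I_r * K}) U :
  (forall x, U x = \sum_beta C beta * \prod_i g i (h i beta) (x i)) ->
  (forall beta, C beta != 0 -> (d beta, h (d beta) beta) \in P) ->
  is_sum_of_slices U #|P|.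
Proof.
move=> UE dP.
pose fibre (p : 'I_r * K) beta :=
  (C beta != 0) && ((d beta, h (d beta) beta) == p).
apply: (@is_sum_of_slices_set _ P (fun p x =>
  \sum_(beta | fibre p beta) C beta * \prod_i g i (h i beta) (x i)))
  => [[i k]|x].
  exists i, (g i k), (fun y => \sum_(beta | fibre (i, k) beta)
    C beta * \prod_(j : {j | j != i}) g (val j) (h (val j) beta) (y j)) => x.
  rewrite mulr_sumr; apply: eq_bigr => beta /andP[_ /eqP[di hk]].
  rewrite mulrCA (bigD1 i)//= -{1}hk di; congr (_ * (_ * _)).
  exact: (big_sub (fun j => j != i) (fun j => g j (h j beta) (x j))).
rewrite UE (bigID (fun beta => C beta != 0)) /= addrC big1 ?add0r; last first.
  by move=> beta /negbNE/eqP ->; rewrite mul0r.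
by rewrite (partition_big (fun beta => (d beta, h (d beta) beta)) (mem P)).
Qed.

Lemma tensor_power_expansion (q n : nat) T
    (b : forall i : 'I_r, 'I_q -> X i -> F) (c : {ffun 'I_r -> 'I_q} -> F) :
  (forall x, T x = \sum_alpha c alpha * \prod_i b i (alpha i) (x i)) ->
  forall x, tensor_power T n x =
    \sum_(beta : {ffun 'I_n -> {ffun 'I_r -> 'I_q}})
      \prod_j c (beta j) * \prod_i \prod_j b i (beta j i) (x i j).
Proof.
move=> TE x; rewrite /tensor_power.
under eq_bigr do rewrite TE.
rewrite bigA_distr_bigA; apply: eq_bigr => beta _.
by rewrite big_split exchange_big.
Qed.

End SliceDecompositions.

(** * Types of words *)

Section Types.
Variables (n : nat) (A : finType).

(** The type of a word in the sense of the method of types: the number of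
occurrences of each letter. *)
Definition type_of (beta : {ffun 'I_n -> A}) : {ffun A -> 'I_n.+1} :=
  [ffun alpha => inord #|[set j | beta j == alpha]%SET|].

Lemma val_type_of beta alpha :
  type_of beta alpha = #|[set j | beta j == alpha]%SET| :> nat.
Proof. by rewrite ffunE inordK// ltnS -[X in (_ <= X)%N]card_ord max_card. Qed.

Lemma sum_type_of (V : nzRingType) (beta : {ffun 'I_n -> A}) (f : A -> V) :
  \sum_j f (beta j) = \sum_alpha (type_of beta alpha)%:R * f alpha.
Proof.
rewrite (partition_big beta xpredT)//=; apply: eq_bigr => alpha _.
rewrite val_type_of mulr_natl -sumr_const.
by apply: eq_big => [j|j /eqP ->]; rewrite ?finset.inE.
Qed.

Lemma type_of_on (Gamma : {set A}) (beta : {ffun 'I_n -> A}) :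
  (forall j, beta j \in Gamma) ->
  type_of beta \in pffun_on ord0 (mem Gamma) predT.
Proof.
move=> bG; apply/pffun_onP; split=> //; apply/fintype.subsetP => alpha.
rewrite finset.inE -val_eqE /= val_type_of -lt0n => /card_gt0P[j].
by rewrite finset.inE => /eqP <-; exact: bG.
Qed.

End Types.

(** * Entropy and slice rank bounds *)

Section Bounds.
Variable R : realType.

(** Otherwise [e i <= eta / W * M i] for all [i], trivially so where [M i = 0],
with [W] the sum of the [M i]. The right hand sides add up to [eta], so equality
holds throughout, which leaves no index with [M i > 0] and contradicts
[W > 0]. *)
Lemma exists_large_share (I : finType) (M e : I -> R) eta : 0 < eta ->
  (forall i, `|e i| <= M i) -> eta <= \sum_i e i ->
  exists i, 0 < M i /\ eta / (\sum_i M i) * M i <= e i.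
Proof.
move=> eta0 eM eta_le; set W := \sum_i M i.
have M0 i : 0 <= M i := le_trans (normr_ge0 _) (eM i).
have W0 : 0 < W.
  apply: (lt_le_trans eta0); apply: (le_trans eta_le).
  by apply: ler_sum => i _; exact: le_trans (ler_norm _) (eM i).
have [//|none] := pselect (exists i, 0 < M i /\ eta / W * M i <= e i).
have small i : e i <= eta / W * M i.
  have := M0 i; rewrite le_eqVlt => /orP[/eqP Mi|Mi].
    by rewrite -Mi mulr0 (le_trans (ler_norm _))// Mi.
  rewrite leNgt; apply/negP => lt_e; apply: none.
  by exists i; split=> //; exact: ltW.
have slack_ge0 i : true -> 0 <= eta / W * M i - e i by rewrite subr_ge0.
have total : \sum_i (eta / W * M i - e i) = 0.
  apply/eqP; rewrite eq_le sumr_ge0// andbT sumrB -mulr_sumr -/W.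
  by rewrite divfK ?gt_eqF// subr_le0.
have tight i : e i = eta / W * M i.
  by apply/esym/eqP; rewrite -subr_eq0; apply/eqP/(psumr_eq0P slack_ge0 total).
have M_eq0 i : M i = 0.
  apply/eqP; rewrite eq_le M0 andbT leNgt; apply/negP => Mi.
  by apply: none; exists i; split=> //; rewrite tight.
by move: W0; rewrite /W big1 ?ltxx.
Qed.

Variables r q : nat.
Local Notation A := {ffun 'I_r -> 'I_q}.
Variables (Gamma : {set A}) (w : 'I_r -> 'I_q -> R) (eta : R).
Hypothesis sep : is_separating Gamma w eta.
Hypothesis Gamma_neq0 : Gamma != finset.set0.
Local Notation W := (\sum_(i < r) sup_norm (w i)).

Lemma ler_sup_norm (v : 'I_q -> R) a : `|v a| <= sup_norm v.
Proof. by rewrite /sup_norm; exact: le_bigmax. Qed.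

Lemma total_sup_norm_gt0 : 0 < W.
Proof.
have [eta0 _ sepG] := sep; have /finset.set0Pn[alpha aG] := Gamma_neq0.
apply: (lt_le_trans eta0); apply: (le_trans (sepG _ aG)).
by apply: ler_sum => i _; exact: le_trans (ler_norm _) (ler_sup_norm _ _).
Qed.

Lemma half_sqr_ratio : eta ^+ 2 / (2 * W ^+ 2) = (eta / W) ^+ 2 / 2.
Proof. by field; rewrite gt_eqF ?total_sup_norm_gt0. Qed.

Lemma ratio_ge0 : 0 <= eta / W.
Proof. by case: sep => eta0 _ _; rewrite divr_ge0 ?ltW ?total_sup_norm_gt0. Qed.

(** The separating inequality averaged against [mu] says that the averages of
the [w i] add up to at least [eta], so [exists_large_share] applies to them. *)
Lemma exists_direction (mu : A -> R) : is_distribution_on Gamma mu ->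
  exists i, 0 < sup_norm (w i) /\
    eta / W * sup_norm (w i) <= \sum_alpha mu alpha * w i (alpha i).
Proof.
have [eta0 _ sepG] := sep; move=> [[mu0 mu1] muG].
apply: (exists_large_share eta0) => [i|].
  rewrite -[leRHS]mul1r -mu1 mulr_suml (le_trans (ler_norm_sum _ _ _))//.
  apply: ler_sum => alpha _; rewrite normrM ger0_norm//.
  by rewrite ler_wpM2l ?ler_sup_norm.
rewrite exchange_big -[leLHS]mul1r -mu1 mulr_suml; apply: ler_sum => alpha _ /=.
rewrite -mulr_sumr; have [aG|aG] := boolP (alpha \in Gamma).
  by rewrite ler_wpM2l ?sepG.
by rewrite muG// !mul0r.
Qed.

Lemma support_entropy_le : (0 < r)%N ->
  support_entropy R Gamma <= ln q%:R - eta ^+ 2 / (2 * W ^+ 2).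
Proof.
move=> r0; have [eta0 w0 _] := sep.
have [[mu mu_on ->] _] := support_entropyP R r0 Gamma_neq0.
have [i [Mi large]] := exists_direction mu_on.
apply: (le_trans ((min_marginal_entropyP r0 mu).2 i)).
rewrite half_sqr_ratio -[X in ln X%:R]card_ord.
apply: (entropy_le _ Mi (ler_sup_norm _) (w0 i) ratio_ge0).
  exact: marginal_distribution mu_on.1.
by rewrite sum_marginal.
Qed.

(** Slices are indexed by a direction [i] and a word in the [i]-th coordinate.
Choosing the direction as a function of the type bounds the number of directions
by the number of types, whatever the value of [r]. *)
Lemma slice_rank_power_le (F : fieldType) (X : finType)
    (T : tensor F (fun _ : 'I_r => X)) (b : 'I_r -> q.-tuple {ffun X -> F^o})
    n :
  (0 < r)%N -> (0 < n)%N -> has_support b T Gamma ->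
  (slice_rank (tensor_power T n))%:R <=
    (n%:R + 1) ^+ #|Gamma| *
    (q%:R * expR (- (eta ^+ 2 / (2 * W ^+ 2)))) ^+ n :> R.
Proof.
move=> r0 n0 [c [TE GammaE]]; have [eta0 w0 sepG] := sep.
have n_gt0 : 0 < n%:R :> R by rewrite ltr0n.
pose large i (s : R) :=
  (0 < sup_norm (w i)) && (n%:R * (eta / W * sup_norm (w i)) <= s).
pose type_sum (tau : {ffun A -> 'I_n.+1}) i :=
  \sum_alpha (tau alpha)%:R * w i (alpha i).
pose types := pffun_on (ord0 : 'I_n.+1) (mem Gamma) predT.
(* The letter sums of [w] are functions of the type, so a large direction can be
   chosen from the type alone; the default direction only serves types that do
   not come from a word. *)
pose dir tau := odflt (Ordinal r0) [pick i | large i (type_sum tau i)].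
have dir_large (beta : {ffun 'I_n -> A}) : (forall j, beta j \in Gamma) ->
    let i := dir (type_of beta) in large i (\sum_j w i (beta j i)).
  move=> bG /=; rewrite (sum_type_of _ (fun alpha : A => w _ (alpha _))).
  rewrite -/(type_sum _ _) /dir; case: pickP => //= none.
  (* The empirical distribution of [beta]. *)
  have mu_on : is_distribution_on Gamma
      (fun alpha => (type_of beta alpha)%:R / n%:R : R).
    split; first split.
    - by move=> alpha; rewrite divr_ge0.
    - rewrite -mulr_suml; have := sum_type_of beta (fun=> 1 : R).
      under [in RHS]eq_bigr do rewrite mulr1.
      by move=> <-; rewrite sumr_const card_ord divff ?gt_eqF.
    - move=> alpha; have /pffun_onP[/fintype.subsetP supp _] := type_of_on bG.
      move=> aG; have : alpha \notin ord0.-support (type_of beta).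
        by apply: contra aG => /supp.
      by rewrite finset.inE negbK => /eqP ->; rewrite mul0r.
  have [i [Mi ge_i]] := exists_direction mu_on.
  have := none i; rewrite /large Mi /= => /negP[].
  rewrite -ler_pdivlMl// (le_trans ge_i)// /type_sum mulr_sumr.
  by apply: ler_sum => alpha _; rewrite mulrA [X in X * _]mulrC.
pose used := [set dir tau | tau in types]%SET.
pose P := [set p : 'I_r * {ffun 'I_n -> 'I_q} |
  (p.1 \in used) && large p.1 (\sum_j w p.1 (p.2 j))]%SET.
have PS : is_sum_of_slices (tensor_power T n) #|P|.
  apply: (@is_sum_of_slices_labels F r (fun=> {ffun 'I_n -> X}) {ffun 'I_n -> A}
    {ffun 'I_n -> 'I_q} (fun beta => \prod_j c (beta j))
    (fun i beta => [ffun j => beta j i])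
    (fun i k x => \prod_j tnth (b i) (k j) (x j))
    (fun beta => dir (type_of beta))).
    move=> x.
    rewrite [LHS](tensor_power_expansion (b := fun i a => tnth (b i) a) TE).
    apply: eq_bigr => beta _; congr (_ * _); apply: eq_bigr => i _.
    by apply: eq_bigr => j _; rewrite ffunE.
  move=> beta /prodf_neq0 c_neq0.
  have bG j : beta j \in Gamma by rewrite GammaE finset.inE c_neq0.
  rewrite finset.inE /= imset_f ?type_of_on//=.
  by under eq_bigr do rewrite ffunE; exact: dir_large.
have card_used : (#|used| <= n.+1 ^ #|Gamma|)%N.
  by rewrite (leq_trans (leq_imset_card _ _))// card_pffun_on card_ord.
rewrite natr1 -natrX.
apply: (@le_trans _ _ #|P|%:R).
  by rewrite ler_nat; exact: (slice_rankP _ r0).2.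
apply: (@le_trans _ _ (\sum_(i in used)
    (q%:R * expR (- (eta ^+ 2 / (2 * W ^+ 2)))) ^+ n)); last first.
  by rewrite sumr_const -[leLHS]mulr_natl ler_wpM2r ?ler_nat.
rewrite -sum1_card natr_sum.
under eq_bigl do rewrite finset.inE.
rewrite -(pair_big_dep (mem used)
  (fun i (a : {ffun 'I_n -> 'I_q}) => large i (\sum_j w i (a j)))
  (fun _ _ => 1%:R)) /=.
apply: ler_sum => i _; have [Mi|Mi] := boolP (0 < sup_norm (w i)); last first.
  rewrite big_pred0 => [|a]; last by rewrite /large (negbTE Mi).
  by rewrite exprn_ge0// mulr_ge0// expR_ge0.
rewrite half_sqr_ratio -[X in X%:R * _]card_ord.
apply: le_trans (card_large_sum_le n Mi (ler_sup_norm _) (w0 i) ratio_ge0).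
rewrite -natr_sum sum1dep_card ler_nat; apply: subset_leq_card.
by apply/fintype.subsetP => a; rewrite !finset.inE => /andP[].
Qed.

End Bounds.

Theorem proposition2p6 (R : realType) (r q : nat)
    (Gamma : {set {ffun 'I_r -> 'I_q}})
    (hr : (2 <= r)%N) (hq : (1 <= q)%N) (hGamma : Gamma != finset.set0)
    (hunif : ~ exists mu : {ffun 'I_r -> 'I_q} -> R,
       is_distribution_on Gamma mu /\ uniform_marginals mu) :
  (exists (w : 'I_r -> 'I_q -> R) (eta : R), is_separating Gamma w eta) /\
  (forall (w : 'I_r -> 'I_q -> R) (eta : R), is_separating Gamma w eta ->
     let W := \sum_(i < r) sup_norm (w i) in
     support_entropy R Gamma <= ln q%:R - eta ^+ 2 / (2 * W ^+ 2) /\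
     forall (F : fieldType) (X : finType) (T : tensor F (fun _ : 'I_r => X))
       (b : 'I_r -> q.-tuple {ffun X -> F^o}),
       #|X| = q ->
       (forall i, basis_of fullv (b i)) ->
       has_support b T Gamma ->
       forall n : nat, (1 <= n)%N ->
         (slice_rank (tensor_power T n))%:R <=
         (n%:R + 1) ^+ #|Gamma| *
         (q%:R * expR (- (eta ^+ 2 / (2 * W ^+ 2)))) ^+ n :> R).
Proof.
have r_gt0 : (0 < r)%N := ltnW hr.
split; first exact: separating_exists.
move=> w eta sep W; split; first exact: support_entropy_le.
move=> F X T b _ _ supp n n_gt0.
exact: (slice_rank_power_le sep hGamma r_gt0 n_gt0 supp).
Qed.
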